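(* Let $\mathcal{R}:\mathbb{X}\to\mathbb{Y}$ be any local randomizer with $\mathbb{Y}=\{y_1,\dots,y_{|\mathbb{Y}|}\}$, and let $x_1^0,x_1^1\in\mathbb{X}$. Put $$a_j=\mathcal{R}(x_1^0)(y_j),\qquad b_j=\mathcal{R}(x_1^1)(y_j),\qquad c_j=\inf_{x\in\mathbb{X}}\mathcal{R}(x)(y_j)\qquad(1\le j\le|\mathbb{Y}|).$$ Then the general clone decomposition $$\mathcal{R}(x_1^0)=\sum_{j=1}^{|\mathbb{Y}|}a_j\mathbb{1}_{y_j},\qquad \mathcal{R}(x_1^1)=\sum_{j=1}^{|\mathbb{Y}|}b_j\mathbb{1}_{y_j},\qquad \mathcal{R}(x_i)=\sum_{j=1}^{|\mathbb{Y}|}c_j\mathbb{1}_{y_j}+\beta Q_i\quad\text{for all } i\in\{2,\dots,n\}$$ (with $\beta=1-\sum_j c_j$ and $Q_i$ the resulting left-over distribution of $x_i$) is equivalent to the privacy blanket framework.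
   Context: $\mathbb{Y}$ is finite, $\mathcal{R}$ is a randomized map, $\mathcal{R}(x)$ denotes its output distribution on input $x$ and $\mathcal{R}(x)(y)$ the probability of output $y$. $\mathbb{1}_{y}$ is the point mass at $y$. $n\ge1$ is the number of users and $x_2,\dots,x_n\in\mathbb{X}$ are arbitrary. General clone decomposition with respect to $(x_1^0,x_1^1)$: probability distributions $Q_1^1,\dots,Q_1^k$ on $\mathbb{Y}$, non-negative coefficients $a_j,b_j,c_j,\beta$ with $\sum_j a_j=\sum_j b_j=\beta+\sum_j c_j=1$, and for each input $x_i\in\mathbb{X}$ a probability distribution $Q_i$ depending only on $x_i$ (the left-over distribution, arbitrary if $\beta=0$), such that $\mathcal{R}(x_1^0)=\sum_j a_jQ_1^j$, $\mathcal{R}(x_1^1)=\sum_j b_jQ_1^j$, $\mathcal{R}(x_i)=\sum_j c_jQ_1^j+\beta Q_i$. Its reduction pair $(P_0^{\mathsf{GC}},P_1^{\mathsf{GC}})$: let $A_0,A_1,A_2$ be distributions on $\{1,\dots,k+1\}$ with $\Pr[A_0=j]=a_j$, $\Pr[A_1=j]=b_j$, $\Pr[A_2=j]=c_j$ for $j\le k$, and $\Pr[A_0=k+1]=\Pr[A_1=k+1]=0$, $\Pr[A_2=k+1]=\beta$. For $a\in\{0,1\}$, $P_a^{\mathsf{GC}}$ is the distribution of the histogram of $n$ independent samples, one from $A_a$ and $n-1$ from $A_2$. Privacy blanket reduction pair: $\gamma=\sum_{y}\inf_{x}\mathcal{R}(x)(y)$ and $\omega(y)=\inf_{x}\mathcal{R}(x)(y)/\gamma$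 ($\omega$ is arbitrary, and irrelevant, if $\gamma=0$). For $a\in\{0,1\}$, $P_a^{\mathsf{B}}$ is the distribution of $(|\boldsymbol b|,Y^a_{|\boldsymbol b|})$, where $|\boldsymbol b|\sim\mathrm{Bin}(n-1,\gamma)$ and, given $|\boldsymbol b|=m$, $Y^a_m$ is the multiset consisting of one sample from $\mathcal{R}(x_1^a)$ and $m$ independent samples from $\omega$. Equivalent to the privacy blanket framework means: for every $n\ge1$ there are (possibly randomized) post-processing functions $f,g$ with $f(P_a^{\mathsf{B}})=P_a^{\mathsf{GC}}$ and $g(P_a^{\mathsf{GC}})=P_a^{\mathsf{B}}$ in distribution for both $a=0,1$ (the same $f$ and the same $g$ for $a=0$ and $a=1$). *)

(* Defs.v *)
From HB Require Import structures.
From mathcomp Require Import all_boot all_order all_algebra.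
From mathcomp Require Import boolp classical_sets functions reals probability.

Set Implicit Arguments.
Unset Strict Implicit.
Unset Printing Implicit Defensive.

Import Order.TTheory GRing.Theory Num.Theory.
Local Open Scope classical_set_scope.
Local Open Scope ring_scope.

Section FiniteDistributions.
Variable R : realType.

Record dist (T : finType) := Dist {
  pmf :> {ffun T -> R};
  pmf_axiom : [forall t, 0 <= pmf t] && (\sum_t pmf t == 1) }.

Lemma pmf_ge0 (T : finType) (p : dist T) t : 0 <= p t.
Proof. by case: p => p /= /andP[/forallP]. Qed.

Lemma pmf_sum1 (T : finType) (p : dist T) : \sum_t p t = 1.
Proof. by case: p => p /= /andP[_ /eqP]. Qed.

Section Make.
Variables (T : finType) (p : T -> R).
Hypotheses (p_ge0 : forall t, 0 <= p t) (p_sum1 : \sum_t p t = 1).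

Fact mkdist_subproof :
  [forall t, 0 <= [ffun u => p u] t] && (\sum_t [ffun u => p u] t == 1).
Proof.
apply/andP; split; first by apply/forallP => t; rewrite ffunE.
by under eq_bigr do rewrite ffunE; rewrite p_sum1.
Qed.

Definition mkdist : dist T := Dist mkdist_subproof.

Lemma mkdistE t : mkdist t = p t.
Proof. by rewrite ffunE. Qed.

End Make.

Section PointMass.
Variables (T : finType) (t0 : T).

Fact point_mass_ge0 (t : T) : 0 <= (t == t0)%:R :> R.
Proof. exact: ler0n. Qed.

Fact point_mass_sum1 : \sum_(t : T) (t == t0)%:R = 1 :> R.
Proof.
by rewrite (bigD1 t0) //= eqxx big1 ?addr0 // => t /negbTE ->.
Qed.

Definition point_mass : dist T := mkdist point_mass_ge0 point_mass_sum1.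
End PointMass.

(* A randomized function from T to U is a kernel f : T -> dist U, and
   post f p is the law of f(t) for t drawn from p. *)
Section Post.
Variables (T U : finType) (f : T -> dist U) (p : dist T).

Fact post_ge0 (u : U) : 0 <= \sum_t p t * f t u.
Proof. by apply: sumr_ge0 => t _; rewrite mulr_ge0 ?pmf_ge0. Qed.

Fact post_sum1 : \sum_u \sum_t p t * f t u = 1.
Proof.
rewrite exchange_big /= -[RHS](pmf_sum1 p); apply: eq_bigr => t _.
by rewrite -mulr_sumr pmf_sum1 mulr1.
Qed.

Definition post : dist U := mkdist post_ge0 post_sum1.
End Post.

Definition image_dist (T U : finType) (h : T -> U) (p : dist T) : dist U :=
  post (fun t => point_mass (h t)) p.

(* Joint law of independent samples, the i-th one drawn from p i. *)
Section Independent.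
Variables (n : nat) (T : finType) (p : 'I_n -> dist T).

Fact indep_ge0 (s : {ffun 'I_n -> T}) : 0 <= \prod_i p i (s i).
Proof. by apply: prodr_ge0 => i _; apply: pmf_ge0. Qed.

Fact indep_sum1 : \sum_(s : {ffun 'I_n -> T}) \prod_i p i (s i) = 1.
Proof.
rewrite -(bigA_distr_bigA (fun i t => p i t)) big1 // => i _; exact: pmf_sum1.
Qed.

Definition indep : dist {ffun 'I_n -> T} := mkdist indep_ge0 indep_sum1.
End Independent.

Section Binomial.
Variables (m : nat) (g : R).
Hypothesis g01 : 0 <= g <= 1.

Fact binomial_dist_ge0 (i : 'I_m.+1) : 0 <= binomial_pmf m g i.
Proof. exact: binomial_pmf_ge0. Qed.

Fact binomial_dist_sum1 : \sum_(i < m.+1) binomial_pmf m g i = 1.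
Proof.
rewrite -(expr1n R m) -[X in _ = X ^+ m](subrK g) exprDn.
by apply: eq_bigr => i _; rewrite /binomial_pmf mulrC.
Qed.

Definition binomial_dist : dist 'I_m.+1 :=
  mkdist binomial_dist_ge0 binomial_dist_sum1.
End Binomial.

End FiniteDistributions.

(* Multisets of at most N elements of T, represented by their multiplicities;
   a histogram of samples is the multiset of their values. *)
Definition multiset (N : nat) (T : finType) := {ffun T -> 'I_N.+1}.

(* Only used for m <= N, in which case inord does not truncate. *)
Definition hist (N m : nat) (T : finType) (s : {ffun 'I_m -> T}) :
  multiset N T := [ffun t => inord #|[set i | s i == t]%SET|].

Section Shuffle.
Variables (R : realType) (X : Type) (Y : finType) (Rz : X -> dist R Y).

Record gc_decomposition (x10 x11 : X) (k : nat) := GCDecomposition {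
  gc_comp : 'I_k -> dist R Y;
  gc_a : 'I_k -> R;
  gc_b : 'I_k -> R;
  gc_c : 'I_k -> R;
  gc_beta : R;
  gc_left : X -> dist R Y;
  gc_a_ge0 : forall j, 0 <= gc_a j;
  gc_b_ge0 : forall j, 0 <= gc_b j;
  gc_c_ge0 : forall j, 0 <= gc_c j;
  gc_beta_ge0 : 0 <= gc_beta;
  gc_a_sum1 : \sum_j gc_a j = 1;
  gc_b_sum1 : \sum_j gc_b j = 1;
  gc_c_sum1 : gc_beta + \sum_j gc_c j = 1;
  gc_x10E : forall y, Rz x10 y = \sum_j gc_a j * gc_comp j y;
  gc_x11E : forall y, Rz x11 y = \sum_j gc_b j * gc_comp j y;
  gc_xE : forall x y,
    Rz x y = \sum_j gc_c j * gc_comp j y + gc_beta * gc_left x y }.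

Section Label.
Variables (k : nat) (p : 'I_k -> R) (r : R).
Hypotheses (p_ge0 : forall j, 0 <= p j) (r_ge0 : 0 <= r).
Hypothesis pr_sum1 : r + \sum_j p j = 1.

Fact label_dist_ge0 (l : 'I_k.+1) : 0 <= oapp p r (unlift ord_max l).
Proof. by case: unlift => /=. Qed.

Fact label_dist_sum1 : \sum_(l < k.+1) oapp p r (unlift ord_max l) = 1.
Proof.
rewrite big_ord_recr /= unlift_none /= addrC -[RHS]pr_sum1; congr (_ + _).
apply: eq_bigr => j _; suff -> : widen_ord (leqnSn k) j = lift ord_max j.
  by rewrite liftK.
by apply: val_inj; rewrite /= /bump leqNgt ltn_ord.
Qed.

(* Mass p j on the labels j < k, and mass r on the extra label ord_max. *)
Definition label_dist : dist R 'I_k.+1 :=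
  mkdist label_dist_ge0 label_dist_sum1.
End Label.

Section GCPair.
Variables (x10 x11 : X) (k : nat) (D : gc_decomposition x10 x11 k).

Definition gc_A0 : dist R 'I_k.+1 :=
  label_dist (gc_a_ge0 D) (lexx 0) (etrans (add0r _) (gc_a_sum1 D)).
Definition gc_A1 : dist R 'I_k.+1 :=
  label_dist (gc_b_ge0 D) (lexx 0) (etrans (add0r _) (gc_b_sum1 D)).
Definition gc_A2 : dist R 'I_k.+1 :=
  label_dist (gc_c_ge0 D) (gc_beta_ge0 D) (gc_c_sum1 D).

(* a = false and a = true stand for the indices 0 and 1. *)
Definition gc_pair (n : nat) (a : bool) : dist R (multiset n 'I_k.+1) :=
  image_dist (@hist n n _)
    (indep (fun i : 'I_n =>
       if val i == 0%N then if a then gc_A1 else gc_A0 else gc_A2)).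

End GCPair.

Definition inf_mass (y : Y) : R := inf (range (fun x => Rz x y)).

Definition blanket_gamma : R := \sum_y inf_mass y.

Lemma inf_mass_ge0 y : 0 <= inf_mass y.
Proof.
rewrite /inf_mass; set E := [set Rz x y | x in setT].
have [->|/set0P E0] := eqVneq E set0; first by rewrite inf0.
by apply: lb_le_inf => // _ [x _ <-]; apply: pmf_ge0.
Qed.

Lemma inf_mass_le x y : inf_mass y <= Rz x y.
Proof.
apply: ge_inf; last by exists x.
by exists 0 => _ [x' _ <-]; apply: pmf_ge0.
Qed.

Lemma blanket_gamma_ge0 : 0 <= blanket_gamma.
Proof. by apply: sumr_ge0 => y _; apply: inf_mass_ge0. Qed.

Lemma blanket_gamma01 : 0 <= blanket_gamma <= 1.
Proof.
rewrite blanket_gamma_ge0 /=.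
have [[x]|X0] := pselect (inhabited X).
  by rewrite -(pmf_sum1 (Rz x)); apply: ler_sum => y _; apply: inf_mass_le.
rewrite /blanket_gamma big1 ?ler01 // => y _; rewrite /inf_mass.
suff -> : range (fun x => Rz x y) = set0 by rewrite inf0.
by rewrite -subset0 => z [x _ _]; apply: X0; exists.
Qed.

(* w0 is the arbitrary value of the blanket distribution for a zero gamma. *)
Section Blanket.
Variable w0 : dist R Y.

Definition blanket_mass (y : Y) : R :=
  if blanket_gamma == 0 then w0 y else inf_mass y / blanket_gamma.

Fact blanket_mass_ge0 y : 0 <= blanket_mass y.
Proof.
rewrite /blanket_mass; case: ifP => _; first exact: pmf_ge0.
by rewrite divr_ge0 ?inf_mass_ge0 ?blanket_gamma_ge0.
Qed.

Fact blanket_mass_sum1 : \sum_y blanket_mass y = 1.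
Proof.
rewrite /blanket_mass; case: (eqVneq blanket_gamma 0) => [_|g0].
  exact: pmf_sum1.
by rewrite -mulr_suml divff.
Qed.

Definition blanket : dist R Y := mkdist blanket_mass_ge0 blanket_mass_sum1.

Definition blanket_pair (x10 x11 : X) (n : nat) (a : bool) :
    dist R ('I_n.-1.+1 * multiset n Y)%type :=
  post (fun m : 'I_n.-1.+1 =>
      image_dist (fun s => (m, hist n s))
        (indep (fun i : 'I_m.+1 =>
           if val i == 0%N then Rz (if a then x11 else x10) else blanket)))
    (binomial_dist n.-1 blanket_gamma01).

End Blanket.

Definition equiv_blanket (x10 x11 : X) (k : nat)
    (D : gc_decomposition x10 x11 k) : Prop :=
  forall (w0 : dist R Y) (n : nat), (1 <= n)%N ->
  exists (f : 'I_n.-1.+1 * multiset n Y -> dist R (multiset n 'I_k.+1))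
         (g : multiset n 'I_k.+1 -> dist R ('I_n.-1.+1 * multiset n Y)%type),
    forall a : bool,
      post f (blanket_pair w0 x10 x11 n a) =1 gc_pair D n a /\
      post g (gc_pair D n a) =1 blanket_pair w0 x10 x11 n a.

(* The left-over distributions are left free: they are determined by the
   decomposition when gc_beta D != 0, and arbitrary otherwise. *)
Definition pointwise_decomposition (x10 x11 : X) (y_ : 'I_#|Y| -> Y)
    (D : gc_decomposition x10 x11 #|Y|) : Prop :=
  [/\ forall j, gc_comp D j = point_mass R (y_ j),
      forall j, gc_a D j = Rz x10 (y_ j),
      forall j, gc_b D j = Rz x11 (y_ j),
      forall j, gc_c D j = inf (range (fun x => Rz x (y_ j)))
    & gc_beta D = 1 - \sum_j gc_c D j].

End Shuffle.

(* Main.v *)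
(* Give every cell of a histogram a formal variable.  The generating polynomial
   of the histogram of independent samples is then the product of the generating
   polynomials of the single samples, and it determines the law of the histogram.
   Let Z be the variable of the left-over label, and let A (for user 1) and
   gamma W (for the blanket part of every other user) be the polynomials of the
   remaining labels.  The clone pair has the generating polynomial
   A (beta Z + gamma W)^(n-1), and expanding this power by the binomial theorem
   exhibits the blanket pair: m is the number of factors gamma W, and the other
   n-1-m users fall into the left-over cell.  As the size of that cell
   determines m, both post-processing maps are deterministic. *)
From mathcomp Require Import all_boot all_order all_algebra.
From mathcomp Require Import reals boolp probability.
From mathcomp Require Import mpoly.
Require Import Defs.

Set Implicit Arguments.
Unset Strict Implicit.
Unset Printing Implicit Defensive.

Import Order.TTheory GRing.Theory Num.Theory.
Local Open Scope ring_scope.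

Lemma sum_unlift_max (V : nmodType) k (F : 'I_k.+1 -> V) :
  \sum_l F l = F ord_max + \sum_j F (lift ord_max j).
Proof.
rewrite big_ord_recr /= addrC; congr (_ + _); apply: eq_bigr => j _.
by congr F; apply: val_inj; rewrite /= /bump leqNgt ltn_ord.
Qed.

Lemma prod_unlift_max (A : comPzRingType) k (F : 'I_k.+1 -> A) :
  \prod_l F l = F ord_max * \prod_j F (lift ord_max j).
Proof.
rewrite big_ord_recr /= mulrC; congr (_ * _); apply: eq_bigr => j _.
by congr F; apply: val_inj; rewrite /= /bump leqNgt ltn_ord.
Qed.

(** * Vector-valued expectations of finite distributions *)

Section Distributions.
Variable R : realType.

(** Values in a module cover two cases at once: polynomials, which give generating functions, and
    scalars in [R^o], which give probabilities. *)
Definition expect (T : finType) (V : lmodType R) (p : dist R T) (F : T -> V) :=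
  \sum_t p t *: F t.

Lemma expect_post (T U : finType) (V : lmodType R) (f : T -> dist R U)
    (p : dist R T) (F : U -> V) :
  expect (post f p) F = expect p (fun t => expect (f t) F).
Proof.
rewrite /expect; under eq_bigr do rewrite mkdistE scaler_suml.
rewrite exchange_big; apply: eq_bigr => t _.
by rewrite scaler_sumr; apply: eq_bigr => u _; rewrite scalerA.
Qed.

Lemma point_massE (T : finType) (t0 t : T) : point_mass R t0 t = (t == t0)%:R.
Proof. exact: mkdistE. Qed.

Lemma expect_point_mass (T : finType) (V : lmodType R) t0 (F : T -> V) :
  expect (point_mass R t0) F = F t0.
Proof.
rewrite /expect (bigD1 t0) //= point_massE eqxx scale1r.
by rewrite big1 ?addr0 // => t /negbTE tt0; rewrite point_massE tt0 scale0r.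
Qed.

Lemma expect_image (T U : finType) (V : lmodType R) (h : T -> U)
    (p : dist R T) (F : U -> V) :
  expect (image_dist h p) F = expect p (F \o h).
Proof.
by rewrite expect_post; apply: eq_bigr => t _; rewrite expect_point_mass.
Qed.

Lemma expect_indicator (T : finType) (p : dist R T) u :
  expect p (fun t => (t == u)%:R : R^o) = p u.
Proof.
rewrite /expect (bigD1 u) //= eqxx big1 ?addr0 => [|t /negbTE ->].
  exact: mulr1.
exact: scaler0.
Qed.

(** This yields the second post-processing map for free: once the blanket pair is pushed to the
    clone pair, a left inverse pushes it back. *)
Lemma image_dist_cancel (T U : finType) (f : T -> U) (g : U -> T)
    (p : dist R T) (q : dist R U) :
  cancel f g -> image_dist f p =1 q -> image_dist g q =1 p.
Proof.
move=> fK fpq t; rewrite -expect_indicator expect_image /expect.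
under eq_bigr do rewrite -fpq.
rewrite -/(expect _ _) expect_image -[RHS]expect_indicator.
by apply: eq_bigr => x _; rewrite /= fK.
Qed.

Lemma expect_indep_prod n (T : finType) (A : comAlgType R)
    (p : 'I_n -> dist R T) (F : T -> A) :
  expect (indep p) (fun s => \prod_i F (s i)) = \prod_i expect (p i) F.
Proof.
rewrite /expect (bigA_distr_bigA (fun i t => p i t *: F t)).
by apply: eq_bigr => s _; rewrite mkdistE scaler_prod.
Qed.

Lemma expect_indep_first n (T : finType) (A : comAlgType R) (p q : dist R T)
    (F : T -> A) :
  expect (indep (fun i : 'I_n.+1 => if val i == 0%N then p else q))
    (fun s => \prod_i F (s i)) = expect p F * expect q F ^+ n.
Proof.
rewrite expect_indep_prod big_ord_recl /=; congr (_ * _).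
by rewrite -[in RHS](card_ord n) -prodr_const; apply: eq_bigr.
Qed.

Lemma expect_label k (p : 'I_k -> R) r (p0 : forall j, 0 <= p j) (r0 : 0 <= r)
    (pr1 : r + \sum_j p j = 1) (V : lmodType R) (F : 'I_k.+1 -> V) :
  expect (label_dist p0 r0 pr1) F =
  r *: F ord_max + \sum_j p j *: F (lift ord_max j).
Proof.
rewrite /expect sum_unlift_max mkdistE unlift_none.
by congr (_ + _); apply: eq_bigr => j _; rewrite mkdistE liftK.
Qed.

End Distributions.

(** * Histograms and their monomials *)

Section Histograms.

Lemma hist_prod (A : comPzRingType) N m (T : finType) (s : {ffun 'I_m -> T})
    (F : T -> A) :
  (m <= N)%N -> \prod_t F t ^+ hist N s t = \prod_i F (s i).
Proof.
move=> mN; rewrite (partition_big s predT) //=; apply: eq_bigr => t _.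
rewrite ffunE inordK; last first.
  by rewrite ltnS (leq_trans _ mN) // -[X in (_ <= X)%N]card_ord max_card.
rewrite -prodr_const; apply: eq_big => i; first by rewrite inE.
by rewrite inE => /eqP ->.
Qed.

Definition hist_mon (R : realType) N K (H : multiset N 'I_K) : {mpoly R[K]} :=
  \prod_j 'X_j ^+ H j.

Lemma hist_monE (R : realType) N K (H : multiset N 'I_K) :
  hist_mon R H = 'X_[[multinom (H j : nat) | j < K]].
Proof. by rewrite mpolyXE_id; apply: eq_bigr => j _; rewrite mnmE. Qed.

(** Distinct histograms have distinct monomials, so the probability of [H] is read off as one
    coefficient. *)
Lemma expect_hist_mon_inj (R : realType) N K (p q : dist R (multiset N 'I_K)) :
  expect p (@hist_mon R N K) = expect q (@hist_mon R N K) -> p =1 q.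
Proof.
have coefE (d : dist R (multiset N 'I_K)) (H : multiset N 'I_K) :
    (expect d (@hist_mon R N K))@_[multinom (H j : nat) | j < K] = d H.
  rewrite -[RHS]expect_indicator raddf_sum; apply: eq_bigr => G _ /=.
  rewrite mcoeffZ hist_monE mcoeffX; congr (_ * (nat_of_bool _)%:R).
  apply/eqP/eqP => [/mnmP GH|-> //]; apply/ffunP => j; apply: val_inj.
  by have := GH j; rewrite !mnmE.
by move=> pq H; rewrite -!coefE pq.
Qed.

End Histograms.

(** * Deterministic recoding between the two views *)

Section Recoding.
Variables (k : nat) (Y : finType) (y_ : 'I_k -> Y) (y_inv : Y -> 'I_k).
Hypotheses (y_K : cancel y_ y_inv) (y_invK : cancel y_inv y_).
Variable N : nat.

(** Here [N] counts the users other than the first. Since [N - u.1] is at most [N], [inord] does not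
    truncate. *)
Definition clone_of_blanket (u : 'I_N.+1 * multiset N.+1 Y) :
    multiset N.+1 'I_k.+1 :=
  [ffun l => oapp (fun j => u.2 (y_ j)) (inord (N - u.1)) (unlift ord_max l)].

Definition blanket_of_clone (H : multiset N.+1 'I_k.+1) :
    'I_N.+1 * multiset N.+1 Y :=
  (inord (N - H ord_max), [ffun y => H (lift ord_max (y_inv y))]).

Lemma clone_of_blanketK : cancel clone_of_blanket blanket_of_clone.
Proof.
case=> m h; congr (_, _).
  rewrite ffunE unlift_none /= inordK; last by rewrite ltnW // ltnS ltnS leq_subr.
  by rewrite subKn ?inord_val // -ltnS.
by apply/ffunP => y; rewrite !ffunE liftK /= y_invK.
Qed.

Lemma hist_mon_clone_of_blanket (R : realType) (m : 'I_N.+1)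
    (s : {ffun 'I_m.+1 -> Y}) :
  hist_mon R (clone_of_blanket (m, hist N.+1 s)) =
  'X_ord_max ^+ (N - m) * \prod_i 'X_(lift ord_max (y_inv (s i))).
Proof.
rewrite /hist_mon prod_unlift_max; congr (_ * _).
  by rewrite ffunE unlift_none /= inordK // ltnW // ltnS ltnS leq_subr.
rewrite -(hist_prod (N := N.+1) s (fun y => 'X_(lift ord_max (y_inv y)))) //.
rewrite (reindex y_) /=; last by apply: onW_bij; exists y_inv.
by apply: eq_bigr => j _; rewrite ffunE liftK /= y_K.
Qed.

End Recoding.

(** * The pointwise decomposition and its generating polynomial *)

Section Equivalence.
Variables (R : realType) (X : Type) (Y : finType) (Rz : X -> dist R Y).
Variables (x10 x11 : X) (y_ : 'I_#|Y| -> Y) (y_inv : Y -> 'I_#|Y|).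
Hypotheses (y_K : cancel y_ y_inv) (y_invK : cancel y_inv y_).

Let y_bij : bijective y_. Proof. by exists y_inv. Qed.

Lemma sum_pointwise (V : nmodType) (F : Y -> V) : \sum_j F (y_ j) = \sum_y F y.
Proof. by rewrite [RHS](reindex y_) //; apply: onW_bij. Qed.

Lemma sum_point_mass (F : Y -> R) y :
  \sum_j F (y_ j) * point_mass R (y_ j) y = F y.
Proof.
rewrite (sum_pointwise (fun z => F z * point_mass R z y)) (bigD1 y) //=.
rewrite point_massE eqxx mulr1 big1 ?addr0 // => z /negbTE zy.
by rewrite point_massE eq_sym zy mulr0.
Qed.

(** The excess of [Rz x] over the infimum is non-negative with total mass [1 - blanket_gamma Rz];
    normalising it gives [Q]. *)
Lemma left_over_exists x : exists Q : dist R Y, forall y,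
  Rz x y = inf_mass Rz y + (1 - blanket_gamma Rz) * Q y.
Proof.
have Rsub_ge0 y : 0 <= Rz x y - inf_mass Rz y by rewrite subr_ge0 inf_mass_le.
have Rsub_sum : \sum_y (Rz x y - inf_mass Rz y) = 1 - blanket_gamma Rz.
  by rewrite sumrB pmf_sum1.
(* With no left-over mass the excess vanishes pointwise, so any [Q] works; [Rz x] is a distribution
   at hand. *)
have [b0|b_neq0] := eqVneq (1 - blanket_gamma Rz) 0.
  exists (Rz x) => y; rewrite b0 mul0r addr0; apply: subr0_eq.
  by move: Rsub_sum; rewrite b0 => /psumr_eq0P ->.
have b_ge0 : 0 <= 1 - blanket_gamma Rz.
  by rewrite subr_ge0; case/andP: (blanket_gamma01 Rz).
have Q_ge0 y : 0 <= (Rz x y - inf_mass Rz y) / (1 - blanket_gamma Rz).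
  exact: divr_ge0.
have Q_sum1 : \sum_y (Rz x y - inf_mass Rz y) / (1 - blanket_gamma Rz) = 1.
  by rewrite -mulr_suml Rsub_sum divff.
by exists (mkdist Q_ge0 Q_sum1) => y; rewrite mkdistE mulrC divfK // addrC subrK.
Qed.

Lemma pointwise_decomposition_exists :
  exists D : gc_decomposition Rz x10 x11 #|Y|, pointwise_decomposition y_ D.
Proof.
have [Q QE] := choice left_over_exists.
have gammaE : \sum_j inf_mass Rz (y_ j) = blanket_gamma Rz.
  exact: sum_pointwise.
have beta_ge0 : 0 <= 1 - blanket_gamma Rz.
  by rewrite subr_ge0; case/andP: (blanket_gamma01 Rz).
have a_sum1 x : \sum_j Rz x (y_ j) = 1 by rewrite sum_pointwise pmf_sum1.
have c_sum1 : 1 - blanket_gamma Rz + \sum_j inf_mass Rz (y_ j) = 1.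
  by rewrite gammaE subrK.
have xE x y : Rz x y = \sum_j inf_mass Rz (y_ j) * point_mass R (y_ j) y
                       + (1 - blanket_gamma Rz) * Q x y.
  by rewrite sum_point_mass.
exists (@GCDecomposition R X Y Rz x10 x11 #|Y| (fun j => point_mass R (y_ j))
  (fun j => Rz x10 (y_ j)) (fun j => Rz x11 (y_ j))
  (fun j => inf_mass Rz (y_ j)) (1 - blanket_gamma Rz) Q
  (fun j => pmf_ge0 (Rz x10) _) (fun j => pmf_ge0 (Rz x11) _)
  (fun j => inf_mass_ge0 Rz (y_ j))
  beta_ge0 (a_sum1 x10) (a_sum1 x11) c_sum1
  (fun y => esym (sum_point_mass _ y)) (fun y => esym (sum_point_mass _ y)) xE).
by split=> //=; rewrite gammaE.
Qed.

(** It survives a zero gamma: the infima are then non-negative with sum zero, hence all zero, and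
    the arbitrary [w0] is multiplied by zero. *)
Lemma gamma_blanket w0 y :
  blanket_gamma Rz * blanket Rz w0 y = inf_mass Rz y.
Proof.
rewrite mkdistE /blanket_mass; have [g0|g_neq0] := eqVneq (blanket_gamma Rz) 0.
  by rewrite g0 mul0r (psumr_eq0P _ g0) // => z _; apply: inf_mass_ge0.
by rewrite mulrC divfK.
Qed.

Variables (D : gc_decomposition Rz x10 x11 #|Y|).
Hypothesis D_pointwise : pointwise_decomposition y_ D.
Variables (w0 : dist R Y) (N : nat) (a : bool).

Let cell (y : Y) : {mpoly R[#|Y|.+1]} := 'X_(lift ord_max (y_inv y)).

Lemma gc_pair_gf :
  expect (gc_pair D N.+1 a) (@hist_mon R N.+1 #|Y|.+1) =
  expect (Rz (if a then x11 else x10)) cell *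
  ((1 - blanket_gamma Rz) *: 'X_ord_max
   + blanket_gamma Rz *: expect (blanket Rz w0) cell) ^+ N.
Proof.
have [_ aE bE cE betaE] := D_pointwise.
have cellE (F : Y -> R) (p : 'I_#|Y| -> R) : (forall j, p j = F (y_ j)) ->
    \sum_j p j *: 'X_(lift ord_max j) = \sum_y F y *: cell y.
  move=> pF; rewrite -sum_pointwise; apply: eq_bigr => j _.
  by rewrite pF /cell y_K.
transitivity (expect (if a then gc_A1 D else gc_A0 D) (fun l => 'X_l) *
              expect (gc_A2 D) (fun l => 'X_l : {mpoly R[#|Y|.+1]}) ^+ N).
  rewrite expect_image -expect_indep_first; apply: eq_bigr => s _.
  by rewrite /= /hist_mon hist_prod.
congr (_ * _ ^+ _).
  (* User 1 never takes the left-over label, so its variable drops out of this factor. *)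
  case: a; rewrite expect_label scale0r add0r; exact: cellE.
rewrite expect_label betaE (cellE (inf_mass Rz)) //.
under [\sum_j gc_c D j]eq_bigr do rewrite cE.
rewrite (sum_pointwise (inf_mass Rz)) scaler_sumr; congr (_ + _).
by apply: eq_bigr => y _; rewrite scalerA gamma_blanket.
Qed.

Lemma clone_of_blanket_pair :
  image_dist (@clone_of_blanket _ _ y_ N) (blanket_pair Rz w0 x10 x11 N.+1 a)
  =1 gc_pair D N.+1 a.
Proof.
apply: expect_hist_mon_inj; rewrite gc_pair_gf expect_image expect_post.
(* In [exprDn] the index is the exponent of the second summand, the gamma term, so it matches the
   binomial outcome [m] term by term. *)
rewrite exprDn mulr_sumr; apply: eq_bigr => m _ /=.
rewrite expect_image.
transitivity (binomial_pmf N (blanket_gamma Rz) m *: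
    ('X_ord_max ^+ (N - m) *
     (expect (Rz (if a then x11 else x10)) cell *
      expect (blanket Rz w0) cell ^+ m))).
  congr (_ *: _); first by rewrite ffunE.
  rewrite -expect_indep_first /expect mulr_sumr.
  apply: eq_bigr => s _; rewrite /= (hist_mon_clone_of_blanket y_K y_invK).
  by rewrite scalerAr.
rewrite /binomial_pmf -scalerMnl mulrnAr; congr (_ *+ _).
by rewrite !exprZn -scalerAl -!scalerAr scalerA mulrC mulrCA.
Qed.

End Equivalence.

Theorem theorem5 (R : realType) (X : Type) (Y : finType)
    (Rz : X -> dist R Y) (x10 x11 : X)
    (y_ : 'I_#|Y| -> Y) (y_bij : bijective y_) :
  (exists D : gc_decomposition Rz x10 x11 #|Y|, pointwise_decomposition y_ D) /\
  (forall D : gc_decomposition Rz x10 x11 #|Y|,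
     pointwise_decomposition y_ D -> equiv_blanket D).
Proof.
have [y_inv y_K y_invK] := y_bij.
split; first exact: pointwise_decomposition_exists y_K y_invK.
(* Writing the number of users as [N.+1] makes its predecessor reduce to [N]. *)
move=> D D_pointwise w0 [//|N] _.
exists (fun u => point_mass R (clone_of_blanket y_ u)).
exists (fun H => point_mass R (blanket_of_clone y_inv H)) => a.
have fE := clone_of_blanket_pair y_K y_invK D_pointwise w0 (N := N) a.
by split=> //; apply: image_dist_cancel fE; apply: clone_of_blanketK.
Qed.
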